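(* If $2\le d\le n/2$, then every homogeneous non-commutative arithmetic circuit computing the ordered symmetric polynomial \[ S_n^d(x_1,\dots,x_n)=\sum_{1\le i_1<\cdots<i_d\le n}\ \prod_{j=1}^d x_{i_j}\in\mathbb{F}\langle x_1,\dots,x_n\rangle \] (product taken in the order $j=1,\dots,d$) has non-scalar size $\Omega(dn)$.
   Context: Let $\mathbb{F}$ be an arbitrary fixed field; polynomials are non-commutative, i.e. elements of $\mathbb{F}\langle x_1,\dots,x_n\rangle$. A polynomial is homogeneous if all its monomials with non-zero coefficient have the same degree. A non-commutative arithmetic circuit is a directed acyclic graph whose in-degree-zero nodes are labelled by variables or field elements, and whose other nodes have in-degree two and are labelled $+$ or $\times$; the two edges into a $\times$ gate are labelled left and right, indicating the order of multiplication. Each gate computes a non-commutative polynomial; the circuit computes $f$ if some gate computes $f$. The circuit is homogeneous if every gate computes a homogeneous polynomial. A product gate is non-scalar if both its inputs compute non-constant polynomials; the non-scalar size is the number of non-scalar product gates. *)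

(* Defs.v *)
From mathcomp Require Import all_boot all_order all_algebra.
From mathcomp Require Import finmap.
From mathcomp.multinomials Require Import monalg.

Set Implicit Arguments.
Unset Strict Implicit.
Unset Printing Implicit Defensive.

Import GRing.Theory.
Local Open Scope ring_scope.

(* The free algebra F<x_1, ..., x_n>, i.e. the monoid algebra over F of the
   free monoid on 'I_n; the variables are indexed from 0. *)
Notation ncpoly F n := {malg F[{fmonom 'I_n}]}.

Definition ncvar (F : fieldType) (n : nat) (i : 'I_n) : ncpoly F n :=
  << fmu i >>.

Definition ncconst (F : fieldType) (n : nat) (c : F) : ncpoly F n := c%:MP.

(* The zero polynomial is homogeneous. *)
Definition homogeneous (F : fieldType) (n : nat) (p : ncpoly F n) : Prop :=
  exists k : nat, forall m : {fmonom 'I_n}, p@_m != 0 -> fdeg m = k.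

Definition is_constant (F : fieldType) (n : nat) (p : ncpoly F n) : bool :=
  p == ncconst n p@_(@mone {fmonom 'I_n}).

Lemma is_constantP (F : fieldType) (n : nat) (p : ncpoly F n) :
  reflect (exists c : F, p = ncconst n c) (is_constant p).
Proof.
apply: (iffP eqP) => [->|[c ->]]; first by eexists.
by rewrite /ncconst malgCK.
Qed.

(* The first argument of GMul is the left factor. Both inputs of a gate may
   come from the same node. *)
Inductive gate (F : fieldType) (n : nat) (V : Type) :=
  | GVar of 'I_n
  | GConst of F
  | GAdd of V & V
  | GMul of V & V.
Arguments GVar {F n V}.
Arguments GConst {F n V}.
Arguments GAdd {F n V}.
Arguments GMul {F n V}.

Definition gate_inputs (F : fieldType) (n : nat) (V : Type)
    (g : gate F n V) : seq V :=
  match g with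
  | GVar _ | GConst _ => [::]
  | GAdd u w | GMul u w => [:: u; w]
  end.

Definition acyclic (V : finType) (e : rel V) : Prop :=
  forall u v : V, e u v -> ~~ connect e v u.

Record circuit (F : fieldType) (n : nat) := Circuit {
  node : finType;
  label : node -> gate F n node;
  label_acyclic : acyclic [rel u v | u \in gate_inputs (label v)]
}.

(* Evaluation to a bounded depth; [gate_polyE] shows that the number of nodes
   is a sufficient bound. *)
Fixpoint eval (F : fieldType) (n : nat) (C : circuit F n) (k : nat)
    (v : node C) : ncpoly F n :=
  if k is k'.+1 then
    match label v with
    | GVar i => ncvar F i
    | GConst c => ncconst n c
    | GAdd u w => eval k' u + eval k' w
    | GMul u w => eval k' u * eval k' w
    end
  else 0.

Definition gate_poly (F : fieldType) (n : nat) (C : circuit F n)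
    (v : node C) : ncpoly F n := eval #|node C| v.

Section GatePoly.
Variables (F : fieldType) (n : nat) (C : circuit F n).

Let wire := [rel u v : node C | u \in gate_inputs (label v)].
Let anc (v : node C) := [set u | connect wire u v].

Let anc_proper u v : wire u v -> (#|anc u| < #|anc v|)%N.
Proof.
move=> uv; apply/proper_card/properP; split.
  apply/subsetP => x; rewrite !inE => xu.
  exact: connect_trans xu (connect1 uv).
by exists v; rewrite !inE ?connect0 // (label_acyclic uv).
Qed.

Let eval_stable k k' v :
  (#|anc v| <= k)%N -> (#|anc v| <= k')%N -> eval k v = eval k' v.
Proof.
have anc_gt0 w : (0 < #|anc w|)%N.
  by apply/card_gt0P; exists w; rewrite inE connect0.
elim: k k' v => [|k IHk] k' v le_vk le_vk'.
  by move: (leq_trans (anc_gt0 v) le_vk).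
case: k' le_vk' => [|k'] le_vk'; first by move: (leq_trans (anc_gt0 v) le_vk').
have IH u : wire u v -> eval k u = eval k' u.
  by move=> /anc_proper lt_uv; apply: IHk; rewrite -ltnS (leq_trans lt_uv).
rewrite /=; move: IH; rewrite /wire /=.
case: (label v) => [i|c|u w|u w] IH; [reflexivity|reflexivity| |];
  by congr (_ _ _); apply: IH; rewrite !inE eqxx ?orbT.
Qed.

Lemma gate_polyE (v : node C) :
  gate_poly v = match label v with
                | GVar i => ncvar F i
                | GConst c => ncconst n c
                | GAdd u w => gate_poly u + gate_poly w
                | GMul u w => gate_poly u * gate_poly w
                end.
Proof.
rewrite {1}/gate_poly (@eval_stable _ #|node C|.+1); first reflexivity.
  exact: max_card.
exact: leqW (max_card _).
Qed.

End GatePoly.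

Definition computes (F : fieldType) (n : nat) (C : circuit F n)
    (f : ncpoly F n) : Prop :=
  exists v : node C, gate_poly v = f.

Definition homogeneous_circuit (F : fieldType) (n : nat) (C : circuit F n) :
    Prop :=
  forall v : node C, homogeneous (gate_poly v).

Definition nonscalar (F : fieldType) (n : nat) (C : circuit F n)
    (v : node C) : bool :=
  if label v is GMul u w
  then ~~ is_constant (gate_poly u) && ~~ is_constant (gate_poly w)
  else false.

Definition nonscalar_size (F : fieldType) (n : nat) (C : circuit F n) : nat :=
  #|[set v : node C | nonscalar v]|.

Definition ordered_sym (F : fieldType) (n d : nat) : ncpoly F n :=
  \sum_(t : d.-tuple 'I_n | sorted ltn (map val t))
     \prod_(j < d) ncvar F (tnth t j).

(* Main.v *)
Require Import Defs.
From HB Require Import structures.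
From mathcomp Require Import all_boot all_order all_algebra.
From mathcomp Require Import finmap zify.
From mathcomp.multinomials Require Import monalg.

Set Implicit Arguments.
Unset Strict Implicit.
Unset Printing Implicit Defensive.

Import Order.TTheory GRing.Theory Num.Theory.
Local Open Scope ring_scope.

(** For a polynomial [p] let [window k p] be the matrix whose [(x, y)] entry is
    the sum of the coefficients of all words of [p] with letters [x], [y] in
    positions [k], [k + 1]. If [g] is homogeneous of degree [a > 0], every
    window of [g h] is a multiple of a window of [g] or of [h], except the one
    at [k = a - 1], which has rank one and does not depend on where [g h] is
    used in the circuit. Hence the windows of all gates lie in a space of
    dimension at most the non-scalar size [s].

    A Baur-Strassen argument for the leftmost letter writes the output as
    [\sum_i x_i R_i] with the windows of all [R_i] in a space of dimension at
    most [2 s]. For the ordered symmetric polynomial, [R_j] is [S^(d-1)] in the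
    variables after [x_j]; the windows of the [R_j], [j <= n - d], at positions
    [k <= d - 3] are linearly independent, as the entries at [x = j + k + 1],
    [y = n - d + k + 2] form a unitriangular matrix. This gives
    [(n - d + 1)(d - 2) <= 2 s]; for [d = 2] the window of [S^2] itself has
    rank [n - 1]. *)

(** * Linear algebra: triangular families *)

Lemma triangular_leq_dim (F : fieldType) (vT : vectType F) (I : finType)
    (U : {vspace vT}) (u : I -> vT) (phi : I -> {linear vT -> F^o})
    (key : I -> nat) :
  (forall i, u i \in U) -> (forall i, phi i (u i) != 0) ->
  (forall i i', i' != i -> phi i (u i') != 0 -> (key i' < key i)%N) ->
  (#|I| <= \dim U)%N.
Proof.
move=> uU phi_diag phi_tri.
pose X := [tuple u (enum_val i) | i < #|I|].
have freeX : free X.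
  apply/freeP => c sum0.
  have sumI : \sum_i c (enum_rank i) *: u i = 0.
    rewrite -[RHS]sum0 [RHS](reindex (@enum_rank I)) /=.
      apply: eq_bigr => i _; rewrite (nth_map (enum_rank i)) ?size_enum_ord //.
      by rewrite nth_ord_enum enum_rankK.
    exact/onW_bij/enum_rank_bij.
  (* Induction on the key: [phi i] kills every other term, except those of smaller key, whose
     coefficients vanish already. *)
  suff c0 m i : (key i < m)%N -> c (enum_rank i) = 0.
    by move=> i; rewrite -(enum_valK i) (c0 (key (enum_val i)).+1).
  elim: m i => // m IHm i; rewrite ltnS => le_im.
  have := congr1 (phi i) sumI.
  rewrite linear0 linear_sum (bigD1 i) //= big1 ?addr0 => [|i' ne_i'].
    rewrite linearZ => /eqP; rewrite mulf_eq0 (negPf (phi_diag i)) orbF.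
    by move/eqP.
  rewrite linearZ /=; have [->|nz] := eqVneq (phi i (u i')) 0.
    by rewrite scaler0.
  by rewrite IHm ?scale0r // (leq_trans (phi_tri _ _ ne_i' nz)).
rewrite -[#|I|](size_tuple X) -(eqP freeX); apply/dimvS/span_subvP => v.
by move=> /mapP[i _ ->].
Qed.

Lemma sum_mulDr2 (R : pzRingType) (I J : finType) (P : pred I) (Q : pred J)
    (a b b' : I -> R) (c e e' : J -> R) :
  (\sum_(i | P i) a i * b i + \sum_(j | Q j) c j * e j) +
  (\sum_(i | P i) a i * b' i + \sum_(j | Q j) c j * e' j) =
  \sum_(i | P i) a i * (b i + b' i) + \sum_(j | Q j) c j * (e j + e' j).
Proof.
rewrite addrACA -!big_split /=.
by congr (_ + _); apply: eq_bigr => ? _; rewrite mulrDr.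
Qed.

(** * Linear functionals on the free algebra *)

Section Pairing.
Variables (F : fieldType) (n : nat).
Implicit Types (p q g h : ncpoly F n) (w : seq 'I_n -> F).

(** Here [mmap] serves as linear extension from words to polynomials; [w] is not assumed
    multiplicative. *)
Definition pairing w p : F := mmap idfun (fun m : {fmonom 'I_n} => w m) p.

Lemma pairing_is_linear w : linear (pairing w : ncpoly F n -> F^o).
Proof.
move=> c p q; rewrite /pairing mmapD; congr (_ + _).
rewrite (mmapEw (msuppZ_le _ _)) mmapE scaler_sumr.
by apply: eq_bigr => m _; rewrite mcoeffZ /= -mulrA.
Qed.

Lemma pairing_sum w (I : Type) (r : seq I) (P : pred I) (G : I -> ncpoly F n) :
  pairing w (\sum_(i <- r | P i) G i) = \sum_(i <- r | P i) pairing w (G i).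
Proof. exact: raddf_sum. Qed.

Lemma pairingU w (m : {fmonom 'I_n}) : pairing w << m >> = w m.
Proof. by rewrite /pairing mmapU /= mul1r. Qed.

(** The factorisation of [w] is asked only on the support of [g], so that a homogeneous [g] fixes
    the position where words of the product are cut. *)
Lemma pairingM w w1 w2 g h :
  (forall m m' : {fmonom 'I_n}, g@_m != 0 -> w (m ++ m') = w1 m * w2 m') ->
  pairing w (g * h) = pairing w1 g * pairing w2 h.
Proof.
move=> wE; rewrite /pairing malgME raddf_sum mulr_suml /=.
apply: eq_big_seq => m m_g; rewrite raddf_sum mulr_sumr; apply: eq_bigr => m' _.
by rewrite /= mmapU /= fmM wE ?mcoeff_neq0 // mulrACA.
Qed.

Lemma pairing_const w c : pairing w (ncconst n c) = c * w [::].
Proof. by rewrite /pairing mmapU fm1. Qed.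

End Pairing.

(** * Windows of products and sums *)

Section Windows.
Variables (F : fieldType) (n : nat).
Implicit Types (p q g h : ncpoly F n) (U : {vspace 'M[F]_n}).

Definition coef_sum p : F := pairing (fun=> 1) p.

(* Words of length at most [k + 1] do not contribute. *)
Definition window (k : nat) p : 'M[F]_n :=
  \matrix_(x, y)
    pairing (fun m => ((onth m k == Some x) && (onth m k.+1 == Some y))%:R) p.

Definition first_letter p : 'rV[F]_n :=
  \row_y pairing (fun m => (onth m 0 == Some y)%:R) p.

(** For the empty word the position is 0, where [onth] finds nothing, so constants do not
    contribute. A column here and a row in [first_letter] make their product a matrix of rank at
    most one. *)
Definition last_letter p : 'cV[F]_n :=
  \col_x pairing (fun m => (onth m (size m).-1 == Some x)%:R) p.

Lemma window_is_linear k : linear (window k).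
Proof.
move=> c p q; apply/matrixP => x y; rewrite !mxE.
exact: pairing_is_linear.
Qed.

HB.instance Definition _ k := GRing.isLinear.Build F (ncpoly F n) 'M[F]_n _
  (window k) (window_is_linear k).

Lemma window_const k c : window k (ncconst n c) = 0.
Proof. by apply/matrixP => x y; rewrite !mxE pairing_const onth0n mulr0. Qed.

Lemma window_var k (i : 'I_n) : window k (ncvar F i) = 0.
Proof.
apply/matrixP => x y; rewrite !mxE pairingU fmU.
by rewrite [onth _ k.+1]onth_default ?andbF.
Qed.

(** As all words of [g] have length [a], positions [k] and [k + 1] lie both in the left factor, or
    on the two sides of the cut, or both in the right factor. *)
Lemma windowM k a g h : (forall m, g@_m != 0 -> fdeg m = a) -> (0 < a)%N ->
  window k (g * h) = if (k.+1 < a)%N then coef_sum h *: window k g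
                     else if k.+1 == a then last_letter g *m first_letter h
                     else coef_sum g *: window (k - a) h.
Proof.
move=> g_a a_gt0; apply/matrixP => x y; case: ltnP => [lt_ka|le_ak].
  rewrite !mxE mulrC; apply: pairingM => m m' /g_a; rewrite fdegE => m_a.
  by rewrite !onth_cat m_a lt_ka ltnW // mulr1.
case: eqP => [k_a|ne_ka].
  rewrite !mxE big_ord1 !mxE; apply: pairingM => m m' /g_a.
  rewrite fdegE => m_a.
  by rewrite !onth_cat m_a -k_a ltnn leqnn subnn -natrM mulnb.
rewrite !mxE; apply: pairingM => m m' /g_a; rewrite fdegE => m_a.
have le_ak' : (a <= k)%N by lia.
by rewrite !onth_cat m_a !ltnNge le_ak' leqW // subSn // mul1r.
Qed.

Lemma homogeneous_nonconstant p : homogeneous p -> ~~ is_constant p ->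
  exists2 a, (0 < a)%N & forall m, p@_m != 0 -> fdeg m = a.
Proof.
case=> -[|a] p_a /is_constantP nc; last by exists a.+1.
case: nc; exists p@_(@mone {fmonom 'I_n}); apply/malgP => m.
rewrite mcoeffC; have [->|m_neq1] := eqVneq m _; first by rewrite mulr1n.
by apply: contraNeq m_neq1 => /p_a /fdeg_eq0I ->.
Qed.

(** Serves twice: for a product gate itself, and for a gate times a cofactor in the left
    expansion. *)
Lemma window_mul_mem U g h : homogeneous g -> ~~ is_constant g ->
  last_letter g *m first_letter h \in U ->
  (forall k, window k g \in U) -> (forall k, window k h \in U) ->
  forall k, window k (g * h) \in U.
Proof.
move=> hom_g nc_g ghU gU hU k.
have [a a_gt0 g_a] := homogeneous_nonconstant hom_g nc_g.
by rewrite (windowM _ _ g_a a_gt0); do 2?case: ifP => _; rewrite ?rpredZ.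
Qed.

Lemma constant_mull p q : is_constant p -> p * q = p@_(@mone _) *: q.
Proof. by move=> /eqP {1}->; rewrite mul_malgC. Qed.

Lemma constant_mulr p q : is_constant q -> p * q = q@_(@mone _) *: p.
Proof.
move=> /is_constantP[c ->]; rewrite malgCK.
rewrite malgM_def fgmulgU [in RHS](monalgE p) scaler_sumr.
apply: eq_bigr => m _; apply/malgP => m'.
by rewrite mcoeffZ !mcoeffU mulm1 mulrnAr mulrC.
Qed.

Lemma is_constantZ c p : is_constant p -> is_constant (c *: p).
Proof.
move=> /is_constantP[c' ->]; apply/is_constantP; exists (c * c').
by apply/malgP => m; rewrite mcoeffZ !mcoeffC mulrnAr.
Qed.

Lemma ncpoly_scale_swap c p q : (c *: p) * q = p * (c *: q).
Proof.
have /constant_mulr pC : is_constant (ncconst n c).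
  by apply/is_constantP; exists c.
by rewrite -(mul_malgC c q) mulrA [p * _]pC malgCK.
Qed.

(** A nonconstant homogeneous polynomial has no constant term, so a constant summand must be 0.
    Addition gates can thus be expanded into nonconstant gates only. *)
Lemma homogeneous_add_nonconstant p q :
  homogeneous (p + q) -> ~~ is_constant (p + q) ->
  homogeneous p -> homogeneous q ->
  p + q = (if is_constant p then 0 else p) + (if is_constant q then 0 else q).
Proof.
move=> hom_pq nc_pq hom_p hom_q.
have coef1 (r : ncpoly F n) :
    homogeneous r -> ~~ is_constant r -> r@_(@mone _) = 0.
  move=> hom_r nc_r; have [a a_gt0 r_a] := homogeneous_nonconstant hom_r nc_r.
  by apply/eqP; apply: contraTT a_gt0 => /r_a <-; rewrite fdeg1.
have const0 (r : ncpoly F n) : is_constant r -> r@_(@mone _) = 0 -> r = 0.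
  by move=> /eqP {2}-> ->; rewrite /ncconst malgC0E.
have := coef1 _ hom_pq nc_pq; rewrite mcoeffD.
case: ifP => [c_p|/negbT nc_p]; case: ifP => [c_q|/negbT nc_q] pq0 //.
- case/is_constantP: nc_pq; exists (p@_(@mone _) + q@_(@mone _)).
  by rewrite /ncconst [RHS]raddfD {1}(eqP c_p) {1}(eqP c_q).
- by rewrite [p]const0 //; move: pq0; rewrite (coef1 q) ?addr0.
- by rewrite [q]const0 //; move: pq0; rewrite (coef1 p) ?add0r.
Qed.

End Windows.

(* Otherwise unification unfolds circuit evaluation and does not return. *)
Local Opaque gate_poly is_constant.

(** * The space containing the windows of all gates *)

Section Circuits.
Variables (F : fieldType) (n : nat) (C : circuit F n).
Hypothesis homC : homogeneous_circuit C.
Implicit Types (u v w : node C) (A : {set node C}) (U : {vspace 'M[F]_n}).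
Implicit Types (p q : ncpoly F n).

Let wire := [rel u v : node C | u \in gate_inputs (label v)].

(** Counting ancestors yields a measure that grows strictly along wires, as the inductions
    require. *)
Definition gate_depth v : nat := #|[set u | connect wire u v]|.

Lemma gate_depth_lt u v :
  u \in gate_inputs (label v) -> (gate_depth u < gate_depth v)%N.
Proof.
move=> uv; apply/proper_card/properP; split.
  apply/subsetP => x; rewrite !inE => xu.
  by apply: connect_trans xu _; apply: connect1.
by exists v; rewrite !inE ?connect0 // (label_acyclic uv).
Qed.

Definition cut_matrix v : 'M[F]_n :=
  if label v is GMul u w
  then last_letter (gate_poly u) *m first_letter (gate_poly w) else 0.

Definition cut_space : {vspace 'M[F]_n} :=
  <<[seq cut_matrix v | v in [set v | nonscalar v]]>>%VS.

Lemma dim_cut_space : (\dim cut_space <= nonscalar_size C)%N.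
Proof. by apply: leq_trans (dim_span _) _; rewrite size_image. Qed.

(** Sums and scalar products create no new windows, and a nonscalar product creates only its own
    [cut_matrix]. *)
Lemma window_gate k v : window k (gate_poly v) \in cut_space.
Proof.
have [m lt_vm] := ubnP (gate_depth v).
elim: m v lt_vm k => // m IHm v; rewrite ltnS => le_vm k.
have IH u : u \in gate_inputs (label v) ->
    forall k, window k (gate_poly u) \in cut_space.
  by move=> /gate_depth_lt lt_uv; apply: IHm (leq_trans lt_uv le_vm).
rewrite gate_polyE; case def_v: (label v) IH => [i|c|u w|u w] IH.
- by rewrite window_var mem0v.
- by rewrite window_const mem0v.
- by rewrite linearD; apply: memvD; apply: IH; rewrite !inE eqxx ?orbT.
have uU := IH u (mem_head _ _).
have wU : forall k, window k (gate_poly w) \in cut_space.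
  by apply: IH; rewrite !inE eqxx orbT.
have [c_u|nc_u] := boolP (is_constant (gate_poly u)).
  by rewrite constant_mull // linearZ /= memvZ.
have [c_w|nc_w] := boolP (is_constant (gate_poly w)).
  by rewrite constant_mulr // linearZ /= memvZ.
apply: window_mul_mem => //.
have -> :
    last_letter (gate_poly u) *m first_letter (gate_poly w) = cut_matrix v.
  by rewrite /cut_matrix def_v.
apply: memv_span; apply/imageP; exists v => //.
rewrite inE.
by rewrite /nonscalar def_v; apply/andP.
Qed.

(** * Expansion by the leftmost letter *)

(** Invariant of the backward pass: [A] holds the gates still to be expanded, and [Q v] is the
    cofactor accumulated at [v]. Constant gates get cofactor 0 because a nonzero constant has no
    leftmost letter to extract. *)
Definition left_expandable U A p : Prop :=
  exists (R : 'I_n -> ncpoly F n) (Q : node C -> ncpoly F n),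
  [/\ p = \sum_i ncvar F i * R i + \sum_(v in A) gate_poly v * Q v,
      forall v, is_constant (gate_poly v) -> Q v = 0,
      forall i k, window k (R i) \in U & forall v k, window k (Q v) \in U].

Lemma left_expandableD U A p q :
  left_expandable U A p -> left_expandable U A q -> left_expandable U A (p + q).
Proof.
move=> [R1 [Q1 [-> Q10 R1U Q1U]]] [R2 [Q2 [-> Q20 R2U Q2U]]].
exists (fun i => R1 i + R2 i), (fun v => Q1 v + Q2 v); split.
- exact: sum_mulDr2.
- by move=> v c_v; rewrite Q10 ?Q20 ?addr0.
- by move=> i k; rewrite linearD /= memvD.
- by move=> v k; rewrite linearD /= memvD.
Qed.

Lemma left_expandableS U U' A p :
  (U <= U')%VS -> left_expandable U A p -> left_expandable U' A p.
Proof.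
move=> /subvP sUU' [R [Q [pE Q0 RU QU]]].
by exists R, Q; split=> // *; apply: sUU'.
Qed.

Lemma left_expandable0 U A : left_expandable U A 0.
Proof.
exists (fun=> 0), (fun=> 0); split=> // *; rewrite ?linear0 ?mem0v //.
by rewrite !big1 ?addr0 // => *; rewrite mulr0.
Qed.

Lemma left_expandable_var U A i q :
  (forall k, window k q \in U) -> left_expandable U A (ncvar F i * q).
Proof.
move=> qU; exists (fun j => if j == i then q else 0), (fun=> 0); split=> //.
- rewrite (bigD1 i) //= eqxx !big1 ?addr0 // => [v _|j /negPf->].
    by rewrite mulr0.
  by rewrite mulr0.
- by move=> j k; case: ifP; rewrite ?linear0 ?mem0v.
- by move=> *; rewrite linear0 mem0v.
Qed.

Lemma left_expandable_gate U A v q :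
  v \in A -> ~~ is_constant (gate_poly v) -> (forall k, window k q \in U) ->
  left_expandable U A (gate_poly v * q).
Proof.
move=> vA nc_v qU.
exists (fun=> 0), (fun u => if u == v then q else 0); split=> //.
- rewrite (bigD1 v) //= eqxx !big1 ?addr0 ?add0r // => [u /andP[_ /negPf->]|*].
    by rewrite mulr0.
  by rewrite mulr0.
- by move=> u; case: eqP => // ->; rewrite (negPf nc_v).
- by move=> *; rewrite linear0 mem0v.
- by move=> u k; case: ifP; rewrite ?linear0 ?mem0v.
Qed.

(* A nonscalar gate [v = g h] turns [v Q] into [g (h Q)], and the only new
   window of [h Q] is the one straddling [h] and [Q]. *)
Lemma left_expandable_step U A v q :
  (cut_space <= U)%VS -> {subset gate_inputs (label v) <= A} ->
  ~~ is_constant (gate_poly v) -> (forall k, window k q \in U) ->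
  exists2 U' : {vspace 'M[F]_n},
    (U <= U')%VS /\ (\dim U' <= \dim U + nonscalar v)%N &
    left_expandable U' A (gate_poly v * q).
Proof.
move=> sGU inA nc_v qU.
have gU w k : window k (gate_poly w) \in U.
  by apply: (subvP sGU); apply: window_gate.
have keep : left_expandable U A (gate_poly v * q) ->
    exists2 U' : {vspace 'M[F]_n},
      (U <= U')%VS /\ (\dim U' <= \dim U + nonscalar v)%N &
      left_expandable U' A (gate_poly v * q).
  by exists U; rewrite ?leq_addr.
have hom_v := homC v.
move: keep nc_v hom_v; rewrite /nonscalar gate_polyE.
case: (label v) inA => [i|c|u w|u w] inA keep nc_v hom_v.
- exact/keep/left_expandable_var.
- by case/is_constantP: nc_v; exists c.
- have uA : u \in A by apply: inA; rewrite mem_head.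
  have wA : w \in A by apply: inA; rewrite !inE eqxx orbT.
  apply: keep; rewrite homogeneous_add_nonconstant // mulrDl.
  by apply: left_expandableD; case: ifPn => nc; rewrite ?mul0r;
    do ?[exact: left_expandable0 | exact: left_expandable_gate].
have uA : u \in A by apply: inA; rewrite mem_head.
have wA : w \in A by apply: inA; rewrite !inE eqxx orbT.
have nc_factor c r : gate_poly u * gate_poly w = c *: r -> ~~ is_constant r.
  by move=> vE; apply: contra nc_v; rewrite vE; apply: is_constantZ.
have qZU c k : window k (c *: q) \in U.
  by rewrite linearZ; apply: memvZ; apply: qU.
have /orP[c_u|nc_u] := orbN (is_constant (gate_poly u)).
  have vE := constant_mull (gate_poly w) c_u.
  apply: keep; rewrite vE ncpoly_scale_swap.
  exact: left_expandable_gate wA (nc_factor _ _ vE) (qZU _).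
have /orP[c_w|nc_w] := orbN (is_constant (gate_poly w)).
  have vE := constant_mulr (gate_poly u) c_w.
  apply: keep; rewrite vE ncpoly_scale_swap.
  exact: left_expandable_gate uA nc_u (qZU _).
pose X := last_letter (gate_poly w) *m first_letter q.
have sUU' : (U <= U + <[X]>)%VS by apply: addvSl.
exists (U + <[X]>)%VS.
  split=> //; have /andP-> := conj nc_u nc_w.
  apply: leq_trans (dimv_add_leqif _ _) _.
  by rewrite leq_add2l dim_vline leq_b1.
have qU' k : window k q \in (U + <[X]>)%VS by apply: (subvP sUU'); apply: qU.
have gU' k : window k (gate_poly w) \in (U + <[X]>)%VS.
  by apply: (subvP sUU'); apply: gU.
have XU' : X \in (U + <[X]>)%VS.
  by apply: (subvP (addvSr _ _)); apply: memv_line.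
rewrite -mulrA; apply: left_expandable_gate uA nc_u _.
exact: window_mul_mem (homC w) nc_w XU' gU' qU'.
Qed.

(** Gates are eliminated from the deepest down. A gate of maximal depth is no input of a gate in
    [A], so [A] stays closed under inputs; each nonscalar gate costs at most one dimension. *)
Lemma left_expandable_set0 U A p :
  (cut_space <= U)%VS ->
  (forall v, v \in A -> {subset gate_inputs (label v) <= A}) ->
  left_expandable U A p ->
  exists2 U' : {vspace 'M[F]_n},
    (\dim U' <= \dim U + #|[set v in A | nonscalar v]|)%N &
    left_expandable U' set0 p.
Proof.
have [m lt_Am] := ubnP #|A|.
elim: m A U lt_Am => // m IHm A U; rewrite ltnS => le_Am sGU clA expA.
have [A0|[v1 v1A]] := set_0Vmem A.
  by exists U; [apply: leq_addr | rewrite -A0].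
case: (arg_maxnP gate_depth v1A) => v vA' v_max.
have {vA'} vA : v \in A by [].
have clA' w : w \in v |: (A :\ v) -> {subset gate_inputs (label w) <= A :\ v}.
  rewrite setD1K // => wA u u_w; rewrite !inE (clA w) // andbT.
  by apply/eqP => u_v; have := v_max _ wA; rewrite /= leqNgt -u_v gate_depth_lt.
have lt_A'm : (#|A :\ v| < m)%N.
  by rewrite (leq_trans _ le_Am) // [#|A|](cardsD1 v) vA.
case: expA => R [Q [pE Q0 RU QU]].
have expA' : left_expandable U (A :\ v)
    (\sum_i ncvar F i * R i + \sum_(u in A :\ v) gate_poly u * Q u).
  by exists R, Q.
have card_ns : #|[set u in A | nonscalar u]| =
    (nonscalar v + #|[set u in A :\ v | nonscalar u]|)%N.
  rewrite [LHS](cardsD1 v) !inE vA; congr (_ + _)%N.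
  by apply: eq_card => u; rewrite !inE andbA.
have [U1 [sUU1 dimU1] expU1] : exists2 U1 : {vspace 'M[F]_n},
    (U <= U1)%VS /\ (\dim U1 <= \dim U + nonscalar v)%N &
    left_expandable U1 (A :\ v) p.
  have -> : p = \sum_i ncvar F i * R i
      + \sum_(u in A :\ v) gate_poly u * Q u + gate_poly v * Q v.
    rewrite pE (big_setD1 v) //= -addrA; congr (_ + _); exact: addrC.
  have [c_v|nc_v] := boolP (is_constant (gate_poly v)).
    by exists U; rewrite ?leq_addr // Q0 // mulr0 addr0.
  have [U1 sUU1 expv] :=
    left_expandable_step sGU (clA' v (setU11 _ _)) nc_v (QU v).
  exists U1 => //; apply: left_expandableD expv.
  by apply: left_expandableS expA'; case: sUU1.
have [|w wA'|U' dimU' expU'] := IHm _ U1 lt_A'm _ _ expU1.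
- exact: subv_trans sGU sUU1.
- by apply: clA'; rewrite setU1r.
exists U' => //; apply: leq_trans dimU' _.
by rewrite card_ns addnA leq_add2r.
Qed.

Lemma left_derivatives v : ~~ is_constant (gate_poly v) ->
  exists (U : {vspace 'M[F]_n}) (R : 'I_n -> ncpoly F n),
  [/\ (\dim U <= 2 * nonscalar_size C)%N,
      gate_poly v = \sum_i ncvar F i * R i &
      forall i k, window k (R i) \in U].
Proof.
move=> nc_v.
have exp_v : left_expandable cut_space setT (gate_poly v).
  (* The pass starts with cofactor 1 at [v], all of whose windows vanish. *)
  rewrite -[gate_poly v]mulr1; apply: left_expandable_gate => // k.
  by rewrite -mpolyC1E window_const mem0v.
have [U dimU [R [Q [vE _ RU _]]]] :=
  left_expandable_set0 (subvv _) (fun _ _ u _ => in_setT u) exp_v.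
exists U, R; split=> //; last by rewrite vE big_set0 addr0.
(* One half of the bound pays for [cut_space], the other for the nonscalar gates eliminated. *)
apply: leq_trans dimU _; rewrite mul2n -addnn leq_add ?dim_cut_space //.
by apply: eq_leq; apply: eq_card => u; rewrite !inE.
Qed.

End Circuits.

(** * Matrix entries as linear functionals *)

Section EntryFunctional.
Variables (F : fieldType) (m n : nat).

Definition mx_entry (x : 'I_m) (y : 'I_n) (M : 'M[F]_(m, n)) : F^o := M x y.

Lemma mx_entry_is_linear x y : linear (mx_entry x y).
Proof. by move=> c M N; rewrite /mx_entry !mxE. Qed.

HB.instance Definition _ x y := GRing.isLinear.Build F 'M[F]_(m, n) F^o _
  (mx_entry x y) (mx_entry_is_linear x y).

End EntryFunctional.

(** * Increasing words and the ordered symmetric polynomial *)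

Lemma sorted_ltn_nth_add (s : seq nat) i e :
  sorted ltn s -> (i + e < size s)%N ->
  (nth 0%N s i + e <= nth 0%N s (i + e))%N.
Proof.
move=> s_inc; elim: e => [|e IHe] lt_s; first by rewrite !addn0.
rewrite !addnS in lt_s *; apply: leq_ltn_trans (IHe (ltnW lt_s)) _.
exact: (sortedP 0%N s_inc).
Qed.

Lemma sum_indicator_neq0 (R : nzRingType) (T : finType) (P Q : pred T) :
  \sum_(t | P t) (Q t)%:R != 0 :> R -> exists2 t, P t & Q t.
Proof.
move=> nz; apply/exists_inP; apply: contraNT nz => /exists_inPn noQ.
by rewrite big1 // => t /noQ /negPf->.
Qed.

Lemma sum_indicator_eq1 (R : nzRingType) (T : finType) (P Q : pred T) (t0 : T) :
  P t0 -> Q t0 -> (forall t, P t -> Q t -> t = t0) ->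
  \sum_(t | P t) (Q t)%:R = 1 :> R.
Proof.
move=> Pt0 Qt0 uniq_t0; rewrite (bigD1 t0) //= Qt0 big1 ?addr0 // => t.
case/andP => Pt ne_t; case: (boolP (Q t)) => // /(uniq_t0 _ Pt) t_t0.
by rewrite t_t0 eqxx in ne_t.
Qed.

Section OrderedSym.
Variables (F : fieldType) (n d : nat).
Implicit Types (t : d.-tuple 'I_n) (w : seq 'I_n -> F).

Lemma prod_ncvar (s : seq 'I_n) : \prod_(i <- s) ncvar F i = << FMonom s >>.
Proof.
elim: s => [|i s IHs]; first by rewrite big_nil -fmoneE.
rewrite big_cons IHs /ncvar malgM_def fgmulUU mulr1; congr << _ *g _ >>.
by apply/eqP; rewrite fmP fmM fmU.
Qed.

Lemma pairing_ordered_sym w :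
  pairing w (ordered_sym F n d) =
  \sum_(t : d.-tuple 'I_n | sorted ltn (map val t)) w t.
Proof.
rewrite pairing_sum; apply: eq_bigr => t _.
have -> : \prod_(j < d) ncvar F (tnth t j) = << FMonom t >>.
  by rewrite -prod_ncvar big_tuple.
exact: pairingU.
Qed.

(** The cofactors are determined by [f]: the words of [R j] are those of [f] starting with [j], with
    that letter removed. Hence the shift of positions by one. *)
Lemma window_left_derivative (f : ncpoly F n) (R : 'I_n -> ncpoly F n) j k x y :
  f = \sum_i ncvar F i * R i ->
  window k (R j) x y = pairing (fun m => [&& onth m 0 == Some j,
    onth m k.+1 == Some x & onth m k.+2 == Some y]%:R) f.
Proof.
have ncvar_supp i m : (ncvar F i)@_m != 0 -> m = fmu i.
  by rewrite mcoeffU; case: (eqVneq (fmu i) m) => [-> //|_]; rewrite eqxx.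
move=> ->; rewrite pairing_sum (bigD1 j) //= big1 => [|i ne_ij].
  rewrite addr0 mxE -[LHS]mul1r -[X in X * _](pairingU (fun=> 1) (fmu j)).
  symmetry; apply: pairingM => m m' /ncvar_supp->.
  by rewrite fmU /= eqxx mul1r.
rewrite (@pairingM _ _ _ (fun=> 0) (fun=> 1)) => [|m m' /ncvar_supp->].
  by rewrite [X in X * _]pairingU mul0r.
by rewrite fmU /= (inj_eq Some_inj) (negPf ne_ij) mul0r.
Qed.

Lemma onth_val t i x : onth t i = Some x ->
  (i < d)%N /\ nth 0%N (map val t) i = x.
Proof.
move=> t_i; have lt_id : (i < d)%N by rewrite -(size_tuple t) -onthTE t_i.
by split=> //; rewrite (nth_map x) ?size_tuple // (onth_nth x _ _ _ t_i).
Qed.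

(** Position [i] is followed by [d - i - 1] strictly larger letters, all below [n]. *)
Lemma sorted_nth_le t i : sorted ltn (map val t) -> (i < d)%N ->
  (nth 0%N (map val t) i + (d - i) <= n)%N.
Proof.
move=> t_inc lt_id; have d_gt0 : (0 < d)%N by apply: leq_ltn_trans lt_id.
have -> : (d - i = (d.-1 - i).+1)%N by lia.
rewrite addnS; apply: leq_ltn_trans (sorted_ltn_nth_add t_inc _) _.
  by rewrite size_map size_tuple; lia.
have lt_d : (i + (d.-1 - i) < size t)%N by rewrite size_tuple; lia.
have [x0 _] : exists x0 : 'I_n, true.
  by case: (tval t) lt_d => [//|x0 ? _]; exists x0.
by rewrite (nth_map x0) // ltn_ord.
Qed.

(** Both bounds are tight at the entry chosen in [left_window_diag]; this produces the triangular
    shape. *)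
Lemma left_window_supp t j k x y : sorted ltn (map val t) ->
  [&& onth t 0 == Some j, onth t k.+1 == Some x & onth t k.+2 == Some y] ->
  (j + k < x)%N /\ (y + d <= n + k.+2)%N.
Proof.
move=> t_inc /and3P[/eqP/onth_val[_ t_j] /eqP/onth_val[lt_k1 t_x]].
move=> /eqP/onth_val[lt_k2 t_y].
have := @sorted_ltn_nth_add _ 0 k.+1 t_inc.
have := sorted_nth_le t_inc lt_k2.
by rewrite size_map size_tuple add0n t_j t_x t_y; lia.
Qed.

(* The sum is [1] because [x] is the least and [y] the greatest value that
   leave room for the other letters, so that all of them are forced. *)
Lemma left_window_diag (j x y : 'I_n) k :
  (k.+2 < d)%N -> (j + d <= n)%N -> x = (j + k.+1)%N :> nat ->
  (y + d = n + k.+2)%N ->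
  pairing (fun m => [&& onth m 0 == Some j,
    onth m k.+1 == Some x & onth m k.+2 == Some y]%:R) (ordered_sym F n d) = 1.
Proof.
move=> lt_kd le_jn xE yE; rewrite pairing_ordered_sym.
(* The forced word: consecutive letters from [j] through position [k + 1], then consecutive letters
   ending in [n - 1]. *)
pose f i := if (i <= k.+1)%N then (j + i)%N else (n - d + i)%N.
have f_inc : {homo f : i i' / (i < i')%N}.
  by move=> i i'; rewrite /f; case: (leqP i k.+1); case: (leqP i' k.+1); lia.
have f_lt i : (i < d)%N -> (f i < n)%N.
  by rewrite /f; case: (leqP i k.+1); lia.
pose t0 : d.-tuple 'I_n := [tuple insubd j (f i) | i < d].
have t0E : map val t0 = mkseq f d.
  rewrite /t0 /= -map_comp /mkseq -val_enum_ord -map_comp.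
  by apply: eq_map => i /=; rewrite val_insubd f_lt.
have t0_onth i (z : 'I_n) : (i < d)%N -> f i = z -> onth t0 i == Some z.
  move=> lt_id fi; apply/eqP; rewrite -[i]/(val (Ordinal lt_id)).
  apply/tnth_onth/val_inj; rewrite tnth_mktuple /= val_insubd fi ltn_ord //.
apply: (@sum_indicator_eq1 _ _ _ _ t0).
- by rewrite t0E /mkseq; apply: homo_sorted f_inc _ (iota_ltn_sorted _ _).
- apply/and3P; split; apply: t0_onth; rewrite /f ?addn0 ?leqnn ?ltnn //;
    by lia.
move=> t t_inc /and3P[/eqP/onth_val[lt_0 t_j] /eqP/onth_val[lt_k1 t_x]].
move=> /eqP/onth_val[lt_k2 t_y].
suff nthE i : (i < d)%N -> nth 0%N (map val t) i = f i.
  apply/val_inj/(inj_map val_inj); rewrite t0E.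
  apply: (@eq_from_nth _ 0%N) => [|i]; rewrite size_map size_tuple.
    by rewrite size_mkseq.
  by move=> lt_id; rewrite nth_mkseq //; apply: nthE.
move=> lt_id; rewrite /f.
have szt : size (map val t) = d by rewrite size_map size_tuple.
have up := sorted_nth_le t_inc lt_id.
case: leqP => [le_ik|lt_ki].
  have lo := @sorted_ltn_nth_add _ 0 i t_inc.
  have hi := @sorted_ltn_nth_add _ i (k.+1 - i) t_inc.
  rewrite szt add0n t_j in lo; rewrite szt (subnKC le_ik) t_x in hi.
  move: (nth 0%N _ i) (lo lt_id) (hi lt_k1) => a; lia.
have := @sorted_ltn_nth_add _ k.+2 (i - k.+2) t_inc.
rewrite szt (subnKC lt_ki) t_y => /(_ lt_id).
move: (nth 0%N _ i) up => a; lia.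
Qed.

End OrderedSym.

(** The key writes a lexicographic order in base [n + 1]: larger [k] comes first, then smaller
    [a]. *)
Lemma lex_key_lt d n k k' a a' :
  (k <= k' < d)%N -> (k' = k -> (a' < a)%N) -> (a' <= n)%N ->
  ((d - k') * n.+1 + a' < (d - k) * n.+1 + a)%N.
Proof.
case/andP=> le_k lt_k'd lt_a le_a'; have [k_eq|ne_k] := eqVneq k' k.
  by rewrite k_eq ltn_add2l lt_a.
have lt_k : (d - k' < d - k)%N by lia.
apply: (@leq_trans ((d - k').+1 * n.+1)%N); first by rewrite mulSn; lia.
by apply: leq_trans (leq_addr _ _); rewrite leq_mul2r lt_k orbT.
Qed.

(** * The lower bounds on the non-scalar size *)

Section LowerBound.
Variables (F : fieldType) (n d : nat) (C : circuit F n).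
Hypotheses (homC : homogeneous_circuit C).
Hypothesis compC : computes C (ordered_sym F n d).

Lemma nonscalar_size_ge_mul : (2 < d <= n)%N ->
  ((n - d).+1 * (d - 2) <= 2 * nonscalar_size C)%N.
Proof.
case/andP=> d_gt2 le_dn; case: compC => v vE.
(* Pairs of a first letter at most [n - d] and a window position at most [d - 3]. *)
pose I : finType := ('I_(n - d).+1 * 'I_(d - 2))%type.
have le_n : ((n - d).+1 <= n)%N by lia.
pose j (i : I) : 'I_n := widen_ord le_n i.1.
(* By [xE] and [yE] below, the default of [insubd] is never taken. *)
pose x (i : I) : 'I_n := insubd (j i) (i.1 + i.2.+1)%N.
pose y (i : I) : 'I_n := insubd (j i) (n - d + i.2.+2)%N.
have jE (i : I) : j i = i.1 :> nat by [].
have bound (i : I) : (i.1 + d <= n)%N /\ (i.2.+2 < d)%N.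
  by have := ltn_ord i.1; have := ltn_ord i.2; lia.
have xE (i : I) : x i = (i.1 + i.2.+1)%N :> nat.
  by have [? ?] := bound i; rewrite /x val_insubd ifT //; lia.
have yE (i : I) : (y i + d)%N = (n + i.2.+2)%N.
  by have [? ?] := bound i; rewrite /y val_insubd ifT; lia.
have diag (i : I) := @left_window_diag F n d (j i) (x i) (y i) i.2
  (bound i).2 (bound i).1 (xE i) (yE i).
have nc_v : ~~ is_constant (gate_poly v).
  have i0 : I by apply: (pair ord0 (Ordinal (_ : 0 < d - 2)%N)); lia.
  apply/is_constantP => -[c vc]; have /eqP := diag i0.
  by rewrite -vE vc pairing_const mulr0 eq_sym oner_eq0.
have [U [R [dimU fE RU]]] := left_derivatives homC nc_v.
rewrite vE in fE; apply: leq_trans dimU.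
have -> : ((n - d).+1 * (d - 2) = #|I|)%N by rewrite card_prod !card_ord.
have pairI (a b : I) : a.1 = b.1 :> nat -> a.2 = b.2 :> nat -> a = b.
  by case: a b => [a1 a2] [b1 b2] /= /val_inj-> /val_inj->.
pose key (i : I) := ((d - i.2) * n.+1 + i.1)%N.
apply: (@triangular_leq_dim _ _ I U (fun i => window i.2 (R (j i)))
  (fun i => mx_entry (x i) (y i)) key) => [i|i|i i' ne_i].
- exact: RU.
- by rewrite /= /mx_entry (window_left_derivative _ _ _ _ fE) diag oner_neq0.
rewrite /= /mx_entry (window_left_derivative _ _ _ _ fE) pairing_ordered_sym.
(* A nonzero entry forces [i.2 <= i'.2] through [y], and when these are equal, [i'.1 <= i.1] through
   [x]. *)
case/sum_indicator_neq0 => t t_inc /(left_window_supp t_inc)[].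
rewrite xE jE => lt_x; rewrite yE leq_add2l !ltnS => le_k.
have [le_i' lt_k'] := bound i'.
apply: lex_key_lt => [|k_eq|].
- by rewrite le_k ltnW ?(ltnW lt_k').
- rewrite k_eq addnS ltnS leq_add2r in lt_x; rewrite ltn_neqAle lt_x andbT.
  by apply: contra ne_i => /eqP e1; apply/eqP/pairI.
exact: leq_trans (leq_addr _ _) le_i'.
Qed.

Definition right_first_letter (v : node C) : 'rV[F]_n :=
  if label v is GMul _ w then first_letter (gate_poly w) else 0.

(** Every row of a column times a row is a multiple of that row, so one vector per nonscalar gate
    spans the rows of all matrices in [cut_space]. *)
Lemma row_cut_space x (M : 'M[F]_n) : M \in cut_space C ->
  row x M \in
    <<[seq right_first_letter v | v in [set v : node C | nonscalar v]]>>%VS.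
Proof.
set W := <<_>>%VS; pose rx := linfun (row x : 'M[F]_n -> 'rV[F]_n).
suff /subvP sub : (cut_space C <= rx @^-1: W)%VS.
  by move=> /sub; rewrite -memv_preim lfunE.
apply/span_subvP => _ /imageP[v ns_v ->]; rewrite -memv_preim lfunE /=.
have := ns_v; rewrite inE /nonscalar /cut_matrix.
case def_v: (label v) => [||u w|u w] // _; rewrite row_mul [row x _]mx11_scalar.
rewrite mul_scalar_mx; apply: memvZ; apply: memv_span; apply/imageP.
by exists v; rewrite // /right_first_letter def_v.
Qed.

(** For [d = 2] the factor [d - 2] makes the previous bound void. The window of the output at 0 has
    ones strictly above the diagonal and zeros elsewhere, and its first [n - 1] rows are
    independent. *)
Lemma nonscalar_size_ge_pred : d = 2%N -> (n.-1 <= nonscalar_size C)%N.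
Proof.
move=> d2; case: compC => v vE.
set W :=
  <<[seq right_first_letter v | v in [set v : node C | nonscalar v]]>>%VS.
have dimW : (\dim W <= nonscalar_size C)%N.
  by apply: leq_trans (dim_span _) _; rewrite size_image.
apply: leq_trans dimW; rewrite -[n.-1]card_ord.
have windowE (x y : 'I_n) : window 0 (gate_poly v) x y = (x < y)%:R.
  rewrite vE mxE pairing_ordered_sym; subst d.
  have [lt_xy|le_yx] := ltnP x y.
    apply: (@sum_indicator_eq1 _ _ _ _ [tuple x; y]) => [||t _].
    - by rewrite /= lt_xy.
    - by rewrite /= !eqxx.
    case/tupleP: t => a t; case/tupleP: t => b t; rewrite (tuple0 t) /=.
    by case/andP=> /eqP[->] /eqP[->]; apply: val_inj.
  apply/eqP; apply: contraLR le_yx => /sum_indicator_neq0[t].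
  case/tupleP: t => a t; case/tupleP: t => b t; rewrite (tuple0 t) /= andbT.
  by move=> lt_ab /andP[/eqP[<-] /eqP[<-]]; rewrite -ltnNge.
have le_n : (n.-1 <= n)%N by apply: leq_pred.
(* Column [i + 1] holds the first nonzero entry of row [i]. *)
pose y (i : 'I_n.-1) : 'I_n := insubd (widen_ord le_n i) i.+1.
have yE (i : 'I_n.-1) : y i = i.+1 :> nat.
  by rewrite /y val_insubd ifT //; have := ltn_ord i; lia.
pose u (i : 'I_n.-1) := row (widen_ord le_n i) (window 0 (gate_poly v)).
apply: (@triangular_leq_dim _ _ _ W u (fun i => mx_entry ord0 (y i)) val).
- by move=> i; apply/row_cut_space/window_gate.
- by move=> i; rewrite /= /mx_entry mxE windowE yE ltnSn oner_neq0.
move=> i i' ne_i; rewrite /= /mx_entry mxE windowE yE /= ltnS.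
have [le_i _|_] := leqP (val i') (val i); last by rewrite eqxx.
by rewrite ltn_neqAle le_i andbT.
Qed.

End LowerBound.

Theorem theorem3p3 :
  exists c : rat, 0 < c /\
    forall (F : fieldType) (n d : nat),
      (2 <= d)%N -> (2 * d <= n)%N ->
      forall C : circuit F n,
        homogeneous_circuit C -> computes C (ordered_sym F n d) ->
        c * (d * n)%:R <= (nonscalar_size C)%:R.
Proof.
(* For [d >= 3], [n - d >= n / 2] and [d - 2 >= d / 3] give [2 s >= d n / 6], where [s] is the
   non-scalar size. For [d = 2], [12 (n - 1) >= 2 n] suffices. *)
exists 12%:R^-1; split=> // F n d d_ge2 le_dn C homC compC.
rewrite ler_pdivrMl // -natrM ler_nat.
have [d_gt2|d_le2] := ltnP 2 d.
  have := nonscalar_size_ge_mul homC compC; rewrite d_gt2 /=.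
  have le_d : (d <= n)%N by lia.
  by move=> /(_ le_d); nia.
have d2 : d = 2%N by lia.
have := nonscalar_size_ge_pred homC compC d2.
by lia.
Qed.
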